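(* Let $N\ge1$. For any $f\in\mathcal C_N$ there is a unique collection of integers $m_{f,I}\in\mathbb Z$, indexed by the nonempty subsets $I\subseteq[N]$, such that for any $\mu\in\mathcal M_N$, $$\mu(f)=\sum_{\emptyset\ne I\subseteq[N]}m_{f,I}\,\mu(u_I).$$
   Context: $\mathcal B_N$ is the free Boolean algebra generated by $x_1,\dots,x_N$, with operations $\cup,\cap$, complement $f\mapsto\bar f$, greatest element $X$, least element $\emptyset$; $f\setminus g=f\cap\bar g$. Put $[N]=\{1,\dots,N\}$. $\mathcal C_N\subset\mathcal B_N$ is the set of elements that can be built from $x_1,\dots,x_N$ using only $\cup,\cap,\setminus$. $\mathcal M_N$ is the linear space of functions $\mu:\mathcal C_N\to\mathbb R$ such that $\mu(f\cup g)=\mu(f)+\mu(g)$ whenever $f,g\in\mathcal C_N$ and $f\cap g=\emptyset$. For $\emptyset\ne I\subseteq[N]$, $u_I=\bigcup_{i\in I}x_i$. *)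

(* Defs.v *)
From HB Require Import structures.
From mathcomp Require Import all_boot all_order all_algebra.
From mathcomp Require Import classical_sets reals.

Set Implicit Arguments.
Unset Strict Implicit.
Unset Printing Implicit Defensive.

Import Order.Theory GRing.Theory.

Local Open Scope order_scope.

(* The library's {tblmorphism B -> T} only requires preservation of \bot and  *)
(* \top, hence this predicate.                                                *)
Definition boolean_morphism (d d' : Order.disp_t) (B : ctbDistrLatticeType d)
    (T : ctbDistrLatticeType d') (h : B -> T) : Prop :=
  [/\ {morph h : f g / f `|` g}, {morph h : f g / f `&` g},
      {morph h : f / ~` f}, h \bot = \bot & h \top = \top].

Definition free_boolean_algebra (d : Order.disp_t)
    (B : ctbDistrLatticeType d) (N : nat) (x : 'I_N -> B) : Prop :=
  forall (d' : Order.disp_t) (T : ctbDistrLatticeType d') (y : 'I_N -> T),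
  exists h : B -> T,
    [/\ boolean_morphism h, forall i, h (x i) = y i &
        forall h' : B -> T, boolean_morphism h' ->
          (forall i, h' (x i) = y i) -> h' =1 h].

Import order.Order.SetSubsetOrder.Exports preorder.Order.SetSubsetOrder.Exports.

Section ConcreteModel.
Variable N : nat.
Local Notation P := {subset {set 'I_N}}.

Definition subset_gen (i : 'I_N) : P := finset (fun A : {set 'I_N} => i \in A).

Section Minterms.
Variables (d : Order.disp_t) (T : ctbDistrLatticeType d) (y : 'I_N -> T).

Definition minterm (A : {set 'I_N}) : T :=
  \meet_(i < N) (if i \in A then y i else ~` (y i)).

Definition subset_extend (F : P) : T :=
  \join_(A in (F : {set {set 'I_N}})) minterm A.

Lemma minterm_le A i : minterm A <= if i \in A then y i else ~` (y i).
Proof. by apply: meets_inf. Qed.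

Lemma minterm_disj A A' : A != A' -> minterm A `&` minterm A' = \bot.
Proof.
move=> neq.
have [i iP] : exists i, (i \in A) != (i \in A').
  apply/existsP; apply: contraR neq; rewrite negb_exists => /forallP e.
  by apply/eqP/setP => i; apply/eqP; have := e i; rewrite negbK.
apply/eqP; rewrite -lex0.
apply: le_trans (leI2 (minterm_le A i) (minterm_le A' i)) _.
by case: (i \in A) (i \in A') iP => -[] //= _; rewrite ?meetxC // meetC meetxC.
Qed.

Lemma subset_extendU : {morph subset_extend : F G / F `|` G}.
Proof. by move=> F G; rewrite /subset_extend joinEsubset joins_setU. Qed.

Lemma subset_extend0 : subset_extend \bot = \bot.
Proof. by rewrite /subset_extend botEsubset big_set0. Qed.

Lemma subset_extendI : {morph subset_extend : F G / F `&` G}.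
Proof.
move=> F G; have disj F' G' : F' `&` G' = \bot ->
    subset_extend F' `&` subset_extend G' = \bot.
  move=> FG0; apply: joins_disjoint => A AG; rewrite meetC.
  apply: joins_disjoint => A' A'F; apply: minterm_disj.
  apply: contraTneq A'F => eA; apply/negP => A'F.
  have : A' \in (F' `&` G' : {set _}) by rewrite meetEsubset inE A'F -eA.
  by rewrite FG0 botEsubset inE.
rewrite -[F in RHS](joinIB G) subset_extendU meetUl.
have -> : subset_extend (F `\` G) `&` subset_extend G = \bot.
  exact/disj/diffIK.
rewrite joinx0; symmetry; apply/meet_idPl.
by rewrite -[in leRHS](joinIB F G) subset_extendU meetC leUl.
Qed.

Lemma subset_extend1 : subset_extend \top = \top.
Proof.
pose lit (A : {set 'I_N}) i := if i \in A then y i else ~` (y i).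
have step (s : seq 'I_N) : forall A : {set 'I_N},
    \meet_(i | i \notin s) lit A i <= subset_extend \top.
  elim: s => [A|j s IHs A].
    by rewrite /subset_extend topEsubset; apply: joins_sup; rewrite inE.
  set q := \meet_(i | _) _.
  have le (A' : {set 'I_N}) : (forall i, i != j -> (i \in A') = (i \in A)) ->
      q `&` lit A' j <= subset_extend \top.
    move=> AA'; apply: le_trans (IHs A'); apply/meetsP => i is_.
    have [->|ij] := eqVneq i j; first exact: leIr.
    rewrite (le_trans (leIl _ _)) // /lit AA' //.
    by apply: meets_inf; rewrite inE negb_or ij.
  rewrite -[q]meetx1 -(joinxC (y j)) meetUr leUx.
  have := le (j |: A); rewrite /lit setU11 => -> /=; last first.
    by move=> i /negbTE ij; rewrite !inE ij.
  have := le (A :\ j); rewrite /lit setD11 => -> //.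
  by move=> i /negbTE ij; rewrite !inE ij.
apply/eqP; rewrite -le1x; apply: le_trans (step (enum 'I_N) finset.set0).
by rewrite big_pred0 // => i; rewrite mem_enum.
Qed.

Lemma compl_unique (a b : T) : a `|` b = \top -> a `&` b = \bot -> b = ~` a.
Proof.
move=> ab1 ab0; apply/le_anti/andP; split.
  by rewrite -[~` a]meet1x -diffE leBRL lex1 meetC ab0 eqxx.
by rewrite -[~` a]meet1x -diffE leBLR ab1.
Qed.

Lemma subset_extend_morph : boolean_morphism subset_extend.
Proof.
split; [exact: subset_extendU|exact: subset_extendI| |exact: subset_extend0
       |exact: subset_extend1].
move=> F; apply: compl_unique.
  by rewrite -subset_extendU joinxC subset_extend1.
by rewrite -subset_extendI meetxC subset_extend0.
Qed.

End Minterms.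

Lemma minterm_subset_gen A B :
  (B \in (minterm subset_gen A : {set _})) = (B == A).
Proof.
apply/idP/eqP => [BA|->].
  apply/setP => i.
  have := minterm_le subset_gen A i; rewrite leEsubset => /fintype.subsetP/(_ B BA).
  by case: (i \in A); rewrite ?complEsubset !inE // => /negbTE.
have : (finset (fun C => C == A) : P) <= minterm subset_gen A.
  apply/meetsP => i _; rewrite leEsubset; apply/fintype.subsetP => C.
  rewrite inE => /eqP ->.
  by case: ifP => iA; rewrite ?complEsubset !inE iA.
by rewrite leEsubset => /fintype.subsetP; apply; rewrite inE.
Qed.

Lemma subset_extend_gen F : subset_extend subset_gen F = F.
Proof.
apply/le_anti/andP; split.
  apply/joinsP => A AF; rewrite leEsubset; apply/fintype.subsetP => B.
  by rewrite minterm_subset_gen => /eqP ->.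
rewrite leEsubset; apply/fintype.subsetP => B BF.
have : minterm subset_gen B <= subset_extend subset_gen F by apply: joins_sup.
by rewrite leEsubset => /fintype.subsetP; apply; rewrite minterm_subset_gen.
Qed.

(* Free Boolean algebras exist: the power set of the power set of 'I_N.       *)
Lemma free_boolean_algebra_subset : free_boolean_algebra subset_gen.
Proof.
move=> d T y; exists (subset_extend y); split.
- exact: subset_extend_morph.
- move=> i; apply/eqP; rewrite eq_le; apply/andP; split.
    apply/joinsP => A; rewrite inE => iA.
    by apply: le_trans (minterm_le y A i) _; rewrite iA.
  have [_ _ eC _ _] := subset_extend_morph y.
  rewrite -leC -eC; apply/joinsP => A; rewrite complEsubset !inE => /negbTE iA.
  by apply: le_trans (minterm_le y A i) _; rewrite iA.
- move=> h [hU hI hC h0 h1] hx F.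
  rewrite -{1}(subset_extend_gen F) /subset_extend.
  rewrite (big_morph h hU h0); apply: eq_bigr => A _.
  rewrite /minterm (big_morph h hI h1); apply: eq_bigr => i _.
  by case: ifP => _; rewrite ?hC hx.
Qed.

End ConcreteModel.

Section GeneratedRing.
Variables (d : Order.disp_t) (B : ctbDistrLatticeType d) (N : nat).
Variable x : 'I_N -> B.

(* As a type, generated_ring is {f : B | f \in generated_ring} (coercion       *)
(* set_type): a function on it is a function of the element of B alone.       *)
Inductive generated_ring : set B :=
| generated_gen i : generated_ring (x i)
| generatedU f g :
    generated_ring f -> generated_ring g -> generated_ring (f `|` g)
| generatedI f g :
    generated_ring f -> generated_ring g -> generated_ring (f `&` g)
| generatedD f g :
    generated_ring f -> generated_ring g -> generated_ring (f `\` g).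

Lemma gen_union_subproof (f g : generated_ring) :
  val f `|` val g \in generated_ring.
Proof. by apply: mem_set; apply: generatedU; apply: set_mem; apply: valP. Qed.

Definition gen_union (f g : generated_ring) : generated_ring :=
  SigSub (gen_union_subproof f g).

Lemma union_of_gens_subproof (I : {I : {set 'I_N} | I != finset.set0}) :
  \join_(i in val I) x i \in generated_ring.
Proof.
apply: mem_set; case: I => I /= /set0Pn[i0 i0I].
rewrite (big_setD1 i0) //= -big_filter.
elim: [seq _ <- _ | _] => [|i s IHs].
  by rewrite big_nil joinx0; constructor.
by rewrite big_cons joinCA; apply: generatedU => //; constructor.
Qed.

Definition union_of_gens (I : {I : {set 'I_N} | I != finset.set0}) : generated_ring :=
  SigSub (union_of_gens_subproof I).

Definition additive_measure (R : realType) (mu : generated_ring -> R) : Prop :=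
  forall f g : generated_ring, val f `&` val g = \bot ->
    mu (gen_union f g) = (mu f + mu g)%R.

End GeneratedRing.

(* Main.v *)
(** Existence: the elements of the generated ring whose measure is an integer
    combination of the [mu (u_I)] are stable under disjoint unions and relative
    complements.  They contain every [\meet_(i in A) gen_join1 \ u_K] with [A]
    nonempty, by induction on [A], since
    [(f & x_j) \ u_K = (f \ u_K) \ (f \ u_(K + j))].  Taking for [K] the
    complement of [A] gives the atoms, and every [f] is a disjoint union of
    atoms.

    Uniqueness: freeness yields, for each [A], a two-valued measure sending
    [u_I] to [1] exactly when [I] meets [A].  Hence a vanishing combination
    [c] satisfies [\sum_(I \subset K) c_I = 0] for all [K], and [c = 0] by
    induction on the cardinal of [I]. *)

Require Import Defs.
From mathcomp Require Import all_boot all_order all_algebra.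
From mathcomp Require Import classical_sets reals.

Set Implicit Arguments.
Unset Strict Implicit.
Unset Printing Implicit Defensive.

Import Order.Theory GRing.Theory Num.Theory.
Import order.Order.SetSubsetOrder.Exports preorder.Order.SetSubsetOrder.Exports.

Local Open Scope order_scope.

(** * Recovering coefficients from sums over the sets that meet a given set *)

Lemma hitting_sums_eq0 (V : zmodType) (T : finType)
    (c : {I : {set T} | I != finset.set0} -> V) :
  (forall A : {set T},
    \sum_(J : {I : {set T} | I != finset.set0} | ~~ [disjoint val J & A]) c J
      = 0)%R ->
  forall J, c J = 0%R.
Proof.
move=> hit.
have inside (K : {set T}) :
    (\sum_(J : {I : {set T} | I != finset.set0} | val J \subset K) c J = 0)%R.
  have total : (\sum_J c J = 0)%R.
    (* Every index is nonempty, hence meets the full set. *)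
    rewrite -[RHS](hit [set: T]); apply: eq_bigl => J.
    by rewrite -setI_eq0 finset.setIT (valP J).
  pose inK (J : {I : {set T} | I != finset.set0}) := val J \subset K.
  move: total; rewrite (bigID inK) /=.
  (* The indices not inside [K] are those that meet its complement. *)
  rewrite [X in (_ + X)%R](_ : _ = 0%R) ?addr0 // -[RHS](hit (~: K)).
  by apply: eq_bigl => J; rewrite finset.disjoints_subset finset.setCK.
move=> J; have [n] := ubnP #|val J|; elim: n J => // n IHn J leJn.
have := inside (val J); rewrite (bigD1 J) //= big1 ?addr0 //.
move=> J' /andP[sub neq]; apply: IHn; apply: leq_trans (proper_card _) leJn.
by rewrite finset.properEneq sub andbT.
Qed.

(** * Integer representations in the generated ring *)

Section Representable.
Variables (R : realType) (N : nat) (d : Order.disp_t).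
Variables (B : ctbDistrLatticeType d) (x : 'I_N -> B).

Definition represents (f : generated_ring x)
    (m : {ffun {I : {set 'I_N} | I != finset.set0} -> int}) : Prop :=
  forall mu : generated_ring x -> R, additive_measure mu ->
    (mu f = \sum_I (m I)%:~R * mu (union_of_gens x I))%R.

(** Stated on [B] so that lattice identities can rewrite [f]; the witness [g] carries membership in
    the ring. *)
Definition representable (f : B) : Prop :=
  exists2 g : generated_ring x, val g = f & exists m, represents g m.

Lemma representable_generated f : representable f -> generated_ring x f.
Proof. by move=> [g <- _]; apply/set_mem/valP. Qed.

Lemma representable_join f g : f `&` g = \bot ->
  representable f -> representable g -> representable (f `|` g).
Proof.
move=> fg0 [f' ef [mf Hf]] [g' eg [mg Hg]]; exists (gen_union f' g').
  by rewrite /= ef eg.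
exists [ffun I => mf I + mg I]%R => mu add_mu.
rewrite add_mu ?ef ?eg // Hf // Hg // -big_split /=.
by apply: eq_bigr => I _; rewrite ffunE intrD mulrDl.
Qed.

(** The join of [f] and [g] is the disjoint union of the difference and [g], so the coefficients
    subtract. *)
Lemma representable_diff f g : generated_ring x f ->
  representable (f `|` g) -> representable g -> representable (f `\` g).
Proof.
move=> Gf [h eh [mh Hh]] [g' eg [mg Hg]].
have Gg : generated_ring x g by rewrite -eg; apply/set_mem/valP.
pose p : generated_ring x := SigSub (mem_set (generatedD Gf Gg)).
exists p => //; exists [ffun I => mh I - mg I]%R => mu add_mu.
have eq_h : mu h = (mu p + mu g')%R.
  rewrite -add_mu /= ?eg ?diffIK //; congr mu; apply: val_inj.
  by rewrite /= eh eg diffUK.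
rewrite -[mu p](addrK (mu g')) -eq_h Hh // Hg // -sumrB.
by apply: eq_bigr => I _; rewrite ffunE intrB mulrBl.
Qed.

(** Bottom arises as the difference of [f] with itself; a member [f] is asked for because the ring
    is empty when [N = 0]. *)
Lemma representable_bot f : generated_ring x f -> representable \bot.
Proof.
move=> Gf.
pose o : generated_ring x := SigSub (mem_set (generatedD Gf Gf)).
have eo : val o = \bot by rewrite /= diffxx.
exists o => //; exists [ffun=> 0%R] => mu add_mu.
rewrite big1; last by move=> I _; rewrite ffunE mul0r.
(* [o] is disjoint from itself, so additivity gives [mu o = mu o + mu o]. *)
apply: (@addrI _ (mu o)); rewrite addr0 -add_mu ?eo ?meetxx //.
by congr mu; apply: val_inj; rewrite /= diffxx joinxx.
Qed.

Lemma representable_union_of_gens (I : {set 'I_N}) :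
  I != finset.set0 -> representable (\join_(i in I) x i).
Proof.
move=> I0; pose J : {I : {set 'I_N} | I != finset.set0} := Sub I I0.
exists (union_of_gens x J) => //.
exists [ffun K => (K == J)%:R]%R => mu _.
rewrite (bigD1 J) //= ffunE eqxx mul1r big1 ?addr0 // => K /negbTE neq.
by rewrite ffunE neq mul0r.
Qed.

(** [x i] stands apart to keep the meet nonempty; [K] varies in the induction because the step uses
    both [K] and [j |: K]. *)
Lemma representable_meetD i (s : seq 'I_N) (K : {set 'I_N}) :
  representable ((x i `&` \meet_(j <- s) x j) `\` \join_(k in K) x k).
Proof.
have gen_join1 : \join_(k in [set i]) x k = x i by rewrite big_set1.
elim: s K => [|j s IHs] K.
  (* The empty join is not one of the [u_I], so an empty [K] is treated apart. *)
  rewrite big_nil meetx1; have [->|K0] := eqVneq K finset.set0.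
    rewrite big_set0 diffx0 -[x i]gen_join1; apply: representable_union_of_gens.
    by rewrite -card_gt0 cards1.
  apply: representable_diff; [exact: generated_gen| |
    exact: representable_union_of_gens].
  rewrite -[x i]gen_join1 -joins_setU; apply: representable_union_of_gens.
  by apply/finset.set0Pn; exists i; rewrite !inE eqxx.
rewrite big_cons meetCA; set f := x i `&` _; set u := \join_(k in K) _.
have joinKj : \join_(k in j |: K) x k = x j `|` u.
  by rewrite joins_setU big_set1.
have -> : (x j `&` f) `\` u = (f `\` u) `\` (f `\` (x j `|` u)).
  rewrite diffxB diffBx (eqP (_ : f `\` (u `|` f) == \bot)) ?diff_eq0 ?leUr //.
  by rewrite join0x meetUr diffIK joinx0 !diffE [RHS]meetAC [f `&` x j]meetC.
apply: representable_diff; last by rewrite -joinKj; apply: IHs.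
  exact: representable_generated (IHs K).
(* Removing more from [f] leaves less, so the join collapses to its first term. *)
rewrite (_ : _ `|` _ = f `\` u); first exact: IHs.
by apply/eqP; rewrite eq_joinl leBr // leUr.
Qed.

(** * Minterms as atoms of the ring *)

Lemma mintermE A : minterm x A = (\meet_(i in A) x i) `\` \join_(i in ~: A) x i.
Proof.
rewrite /minterm (bigID (mem A)) /= diffE compl_joins; congr (_ `&` _).
  by apply: eq_bigr => i ->.
by apply: eq_big => i; rewrite ?inE // => /negbTE ->.
Qed.

Lemma representable_minterm A : A != finset.set0 -> representable (minterm x A).
Proof.
case/finset.set0Pn => i iA; rewrite mintermE.
rewrite (_ : \meet_(j in A) x j = x i `&` \meet_(j <- enum (A :\ i)) x j).
  exact: representable_meetD.
by rewrite big_enum (big_setD1 i).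
Qed.

(** A minterm lies below each generator or below its complement, and this dichotomy survives the
    three operations. *)
Lemma generated_minterm f A : generated_ring x f ->
  minterm x A <= f \/ f `&` minterm x A = \bot.
Proof.
elim=> [i|{}f g _ [lef|f0] _ [leg|g0]|{}f g _ [lef|f0] _ [leg|g0]
       |{}f g _ [lef|f0] _ [leg|g0]].
- have := minterm_le x A i; case: ifP => _ le; [by left|right].
  by apply/eqP; rewrite -lex0 -(meetxC (x i)) leI2.
- by left; rewrite lexUl.
- by left; rewrite lexUl.
- by left; rewrite lexUr.
- by right; rewrite meetUl f0 g0 joinxx.
- by left; rewrite lexI lef leg.
- by right; rewrite -meetA g0 meetx0.
- by right; rewrite meetAC f0 meet0x.
- by right; rewrite meetAC f0 meet0x.
- by right; rewrite -(meet_idPl leg) meetCA diffIK meetx0.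
- by left; rewrite leBRL lef meetC g0 eqxx.
- by right; rewrite diffE meetAC f0 meet0x.
- by right; rewrite diffE meetAC f0 meet0x.
Qed.

(** This disposes of the one minterm that [representable_minterm] excludes: it lies below the
    complement of every generator. *)
Lemma generated_minterm0 f : generated_ring x f ->
  f `&` minterm x finset.set0 = \bot.
Proof.
elim=> [i|{}f g _ f0 _ g0|{}f g _ f0 _ g0|{}f g _ f0 _ g0].
- apply/eqP; rewrite -lex0 -(meetxC (x i)) leI2 //.
  by have := minterm_le x finset.set0 i; rewrite inE.
- by rewrite meetUl f0 g0 joinxx.
- by rewrite meetAC f0 meet0x.
- by rewrite diffE meetAC f0 meet0x.
Qed.

Lemma representable_meet_minterm f A :
  generated_ring x f -> representable (f `&` minterm x A).
Proof.
move=> Gf; have [le|->] := generated_minterm A Gf; last first.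
  exact: representable_bot Gf.
have [->|A0] := eqVneq A finset.set0.
  by rewrite generated_minterm0 //; apply: representable_bot Gf.
by rewrite (meet_idPr le); apply: representable_minterm.
Qed.

Lemma joins_minterm : \join_(A : {set 'I_N}) minterm x A = \top.
Proof.
rewrite -(subset_extend1 x) /subset_extend topEsubset.
by apply: eq_bigl => A; rewrite inE.
Qed.

Lemma generated_representable f : generated_ring x f -> representable f.
Proof.
move=> Gf.
(* Lists without repetition let the pairwise disjoint pieces of [f] be added one at a time. *)
suff H (s : seq {set 'I_N}) :
    uniq s -> representable (f `&` \join_(A <- s) minterm x A).
  by have := H _ (index_enum_uniq _); rewrite joins_minterm meetx1.
elim: s => [_|A s IHs /= /andP[As us]].
  by rewrite big_nil meetx0; apply: representable_bot Gf.
rewrite big_cons meetUr; apply: representable_join (IHs us).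
  rewrite meetACA; apply/eqP; rewrite -lex0 leIxr // lex0.
  rewrite big_uniq // joins_disjoint // => A' A's.
  by apply: minterm_disj; apply: contraNneq As => ->.
exact: representable_meet_minterm.
Qed.

(** * Test measures and uniqueness *)

Hypothesis x_free : free_boolean_algebra x.

Lemma two_valued_measure (A : {set 'I_N}) :
  exists2 mu : generated_ring x -> R, additive_measure mu &
    forall I, mu (union_of_gens x I) = (~~ [disjoint val I & A])%:R%R.
Proof.
(* Freeness is applied to the two-element algebra [bool]: [h] evaluates at the truth assignment
   given by [A]. *)
have [h [[hU hI _ h0 _] hx _]] := x_free (fun i => i \in A).
exists (fun f => (h (val f))%:R%R) => [f g fg0|I].
  rewrite /= hU; have := hI (val f) (val g); rewrite fg0 h0.
  by case: (h (val f)) (h (val g)) => -[] //= _; rewrite ?addr0 ?add0r.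
congr (_%:R)%R; rewrite /= (big_morph h hU h0) -setI_eq0.
rewrite (eq_bigr (fun i => i \in A)) // big_orE.
congr nat_of_bool; apply/exists_inP/finset.set0Pn => [[i iI iA]|[i]].
  by exists i; rewrite inE iI.
by rewrite inE => /andP[iI iA]; exists i.
Qed.

Lemma represents_uniq f m m' : represents f m -> represents f m' -> m = m'.
Proof.
move=> Hm Hm'; apply/ffunP => I; apply/eqP; rewrite -subr_eq0; apply/eqP.
pose c J := (m J - m' J)%R.
apply: (@hitting_sums_eq0 _ _ c) => A.
have [mu add_mu muE] := two_valued_measure A.
(* The integer sum is tested in [R], where it is the difference of the two expansions of [mu f]. *)
apply/eqP; rewrite -(intr_eq0 R) rmorph_sum /= big_mkcond; apply/eqP.
rewrite -[RHS](subrr (mu f)) {1}(Hm _ add_mu) (Hm' _ add_mu) -sumrB.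
apply: eq_bigr => J _; rewrite muE -mulrBl -intrB.
by case: ifP => _; rewrite ?mulr1 ?mulr0.
Qed.

End Representable.

Theorem proposition5 (R : realType) (N : nat) (hN : (1 <= N)%N)
    (d : Order.disp_t) (B : ctbDistrLatticeType d) (x : 'I_N -> B)
    (hB : free_boolean_algebra x) (f : generated_ring x) :
  exists! m : {ffun {I : {set 'I_N} | I != finset.set0} -> int},
    forall mu : generated_ring x -> R, additive_measure mu ->
      mu f = (\sum_(I : {I : {set 'I_N} | I != finset.set0})
                (m I)%:~R * mu (union_of_gens x I))%R.
Proof.
have [g /val_inj <- [m Hm]] := generated_representable R (set_mem (valP f)).
by exists m; split=> // m' Hm'; exact: (represents_uniq hB Hm Hm').
Qed.
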